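(* Let $d\ge1$ be an integer, let $\ell,\delta,K>0$ and $\gamma\ge0$. Let $p$ and $q$ be real-valued polynomials of degree $d$, with coefficients of $x^d$ denoted $p_d$ and $q_d$ respectively, and let $S$ be a $\delta$-separated collection of points in $[-\ell,\ell]$ (distinct points of $S$ are at distance at least $\delta$) with $|S|\ge2d+1$. Suppose that $$\sup_{x\in S}|p^2(x)-q^2(x)|\le\gamma\qquad\text{and}\qquad\inf_{x\in S}|q(x)|\ge K.$$ Then $$\big||p_d|-|q_d|\big|\le2^{2d+1}e^{2d}(d\delta)^{-d}K^{-1}\gamma.$$ *)

(* Defs.v *)
From HB Require Import structures.
From mathcomp Require Import all_boot all_order all_algebra.
From mathcomp Require Import all_classical all_reals all_analysis.

Set Implicit Arguments.
Unset Strict Implicit.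
Unset Printing Implicit Defensive.

Import Order.TTheory GRing.Theory Num.Theory.

Local Open Scope classical_set_scope.
Local Open Scope ring_scope.

Definition delta_separated (R : realType) (delta : R) (S : set R) : Prop :=
  forall x y : R, S x -> S y -> x != y -> delta <= `|x - y|.

(* Main.v *)
Require Import Defs.
From HB Require Import structures.
From mathcomp Require Import all_boot all_order all_algebra.
From mathcomp Require Import all_classical all_reals all_analysis.
From mathcomp Require Import ring lra.

Set Implicit Arguments.
Unset Strict Implicit.
Unset Printing Implicit Defensive.

Import Order.TTheory GRing.Theory Num.Theory.
Import numFieldNormedType.Exports.

Local Open Scope classical_set_scope.
Local Open Scope ring_scope.

(** Since |p - q| + |p + q| >= 2|q| >= 2K, at each point of S one of the two
    factors of p^2 - q^2 is at most gamma / K in absolute value. By pigeonhole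
    a single factor r = p - q or r = p + q is this small at d + 1 of the
    points. The coefficient of X^d in r is the divided difference of r at these
    points; with delta-spaced nodes it is at most
    (gamma / K) 2^d / (d! delta^d), and d^d <= e^d d!. *)

Lemma spaced_ge (R : realFieldType) (delta : R) (n : nat) (x : nat -> R) :
  (forall i, (i < n)%N -> x i + delta <= x i.+1) ->
  n%:R * delta <= x n - x 0.
Proof.
elim: n => [|n IHn] hx; first by rewrite mul0r subrr.
have h1 := hx n (ltnSn n).
have {IHn} h2 := IHn (fun i hi => hx i (ltnW hi)).
by rewrite -natr1 mulrDl mul1r; lra.
Qed.

(* Neville's recursion: its leading coefficient is the divided difference, so
   each step gains a factor at most 2 / (n delta). *)
Lemma interpolation_coef_le (R : realFieldType) (delta M : R) (f : R -> R)
    (n : nat) (x : nat -> R) :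
  0 < delta -> (forall i, (i < n)%N -> x i + delta <= x i.+1) ->
  (forall i, (i <= n)%N -> `|f (x i)| <= M) ->
  exists P : {poly R}, [/\ (size P <= n.+1)%N,
    forall i, (i <= n)%N -> P.[x i] = f (x i) &
    `|P`_n| * (n`!%:R * delta ^+ n) <= M * 2 ^+ n].
Proof.
move=> d0; elim: n x => [|n IHn] x hx hf.
  exists (f (x 0))%:P; split.
  - by rewrite size_polyC; case: eqP.
  - by move=> i; rewrite leqn0 => /eqP->; rewrite hornerC.
  - by rewrite coefC /= fact0 !expr0 !mulr1 hf.
have [|i hi|P0 [sP0 eP0 bP0]] := IHn x.
- by move=> i hi; apply: hx; apply: ltnW.
- by apply: hf; apply: leqW.
(* [P0] interpolates at nodes 0 to [n]; on the shifted sequence, [P1] interpolates at nodes 1 to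
   [n.+1]. *)
have [|i hi|P1 [sP1 eP1 bP1]] := IHn (x \o S).
- by move=> i hi /=; apply: hx.
- exact: hf.
have hD := spaced_ge hx.
have n0 : 0 < n.+1%:R * delta by rewrite mulr_gt0 // ltr0n.
have D0 : 0 < x n.+1 - x 0 := lt_le_trans n0 hD.
have szX (c : R) (P : {poly R}) : (size P <= n.+1)%N ->
    (size (('X - c%:P) * P)%R <= n.+2)%N.
  move=> sP; apply: leq_trans (size_polyMleq _ _) _.
  by rewrite size_XsubC /= ltnS.
have coX (c : R) (P : {poly R}) : (size P <= n.+1)%N ->
    (('X - c%:P) * P)`_n.+1 = P`_n.
  move=> sP; rewrite mulrBl coefB coefXM coefCM (nth_default _ sP) /=.
  by rewrite mulr0 subr0.
exists ((x n.+1 - x 0)^-1 *: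
  (('X - (x 0)%:P) * P1 - ('X - (x n.+1)%:P) * P0)); split.
- apply: leq_trans (size_scale_leq _ _) _.
  by apply: leq_trans (size_polyD _ _) _; rewrite geq_max size_polyN !szX.
- move=> i hi; rewrite !hornerE /=.
  (* At each end node one linear factor vanishes and a single interpolant survives. At an inner node
     both interpolants agree with [f], and the weights sum to [x n.+1 - x 0]. *)
  case: i hi => [|i] hi.
    by rewrite eP0 // subrr; field; apply: lt0r_neq0.
  rewrite (eP1 i) //=; move: hi; rewrite leq_eqVlt => /predU1P[[->]|hi].
    by rewrite subrr; field; apply: lt0r_neq0.
  by rewrite (eP0 i.+1) //; field; apply: lt0r_neq0.
- rewrite coefZ coefB !coX // normrM normfV (gtr0_norm D0).
  rewrite factS natrM exprS [2 ^+ _]exprS.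
  set c := n`!%:R * delta ^+ n in bP0 bP1.
  have c0 : 0 <= c by rewrite mulr_ge0 ?ler0n // exprn_ge0 // ltW.
  have h : `|P1`_n - P0`_n| * c <= M * (2 * 2 ^+ n).
    apply: le_trans (_ : (`|P1`_n| + `|P0`_n|) * c <= _).
      by apply: ler_wpM2r => //; apply: ler_normB.
    by rewrite mulrDl; lra.
  (* The new factor [n.+1 * delta] of the normalisation is paired with the divisor; by [hD] their
     ratio is at most 1. *)
  have -> : (x n.+1 - x 0)^-1 * `|P1`_n - P0`_n| *
      (n.+1%:R * n`!%:R * (delta * delta ^+ n)) =
      (`|P1`_n - P0`_n| * c) * ((n.+1%:R * delta) / (x n.+1 - x 0)).
    by rewrite /c; field; apply: lt0r_neq0.
  apply: le_trans h; apply: ler_piMr; first by rewrite mulr_ge0.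
  by rewrite ler_pdivrMr // mul1r.
Qed.

(** The interpolant of [r] at [n.+1] distinct nodes is [r] itself: the difference has more roots
    than its degree allows. *)
Lemma spaced_coef_le (R : realFieldType) (delta M : R) (r : {poly R})
    (n : nat) (s : seq R) :
  0 < delta -> (size r <= n.+1)%N -> size s = n.+1 -> uniq s ->
  (forall i, (i < n)%N -> s`_i + delta <= s`_i.+1) ->
  (forall y, y \in s -> `|r.[y]| <= M) ->
  `|r`_n| * (n`!%:R * delta ^+ n) <= M * 2 ^+ n.
Proof.
move=> d0 sr ss us hs hM.
have [i hi|P [sP eP bP]] := interpolation_coef_le (f := horner r) d0 hs (M := M).
  by apply: hM; rewrite mem_nth // ss.
suff -> : r = P by [].
apply/eqP; rewrite -subr_eq0; apply/eqP/(@roots_geq_poly_eq0 _ _ s) => //.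
  apply/(all_nthP 0) => i; rewrite ss => hi.
  by rewrite /root hornerD hornerN eP // subrr.
by rewrite ss; apply: leq_trans (size_polyD _ _) _; rewrite geq_max sr size_polyN.
Qed.

(** Sorting turns pairwise separation into gaps between consecutive nodes; the [n.+1] smallest
    points suffice. *)
Lemma separated_coef_le (R : realType) (delta M : R) (S : set R)
    (r : {poly R}) (n : nat) (s : seq R) :
  0 < delta -> delta_separated delta S -> (size r <= n.+1)%N ->
  (n < size s)%N -> uniq s -> (forall y, y \in s -> S y /\ `|r.[y]| <= M) ->
  `|r`_n| * (n`!%:R * delta ^+ n) <= M * 2 ^+ n.
Proof.
move=> d0 sep sr ss us hs.
pose t := take n.+1 (sort <=%R s).
have st : size t = n.+1 by rewrite size_takel // size_sort.
have ut : uniq t by rewrite take_uniq // sort_uniq.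
have ts y : y \in t -> y \in s by move=> /mem_take; rewrite mem_sort.
have sot : sorted <=%R t by apply: take_sorted; apply: sort_le_sorted.
apply: (@spaced_coef_le _ delta M r n t) => // [i hi|y /ts /hs[]//].
have h1 : (i < size t)%N by rewrite st ltnW // ltnS.
have h2 : (i.+1 < size t)%N by rewrite st ltnS.
have le : t`_i <= t`_i.+1.
  by apply: (sorted_leq_nth le_trans le_refl) => //; rewrite ?inE.
have ne : t`_i.+1 != t`_i by rewrite nth_uniq // gtn_eqF.
have := sep _ _ (hs _ (ts _ (mem_nth 0 h2))).1 (hs _ (ts _ (mem_nth 0 h1))).1 ne.
by rewrite ger0_norm ?subr_ge0 //; lra.
Qed.

(** [n ^ n / n!] is a single term of the exponential series at [n]. *)
Lemma exprn_le_expR_fact (R : realType) (n : nat) :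
  (n%:R : R) ^+ n <= expR n%:R * n`!%:R.
Proof.
case: n => [|n]; first by rewrite expr0 expR0 mul1r.
have h := @expR_ge1Dxn R n.+1%:R n (ler0n _ _).
rewrite -ler_pdivrMr ?ltr0n ?fact_gt0 //.
by apply: le_trans h; rewrite lerDr.
Qed.

Lemma card_II_le_injection (T : pointedType) (n : nat) (S : set T) :
  (`I_n #<= S)%card ->
  exists f : nat -> T, {in `I_n &, injective f} /\ forall i, (i < n)%N -> S (f i).
Proof.
move=> /pcard_leP[f]; exists f; split=> [i j hi hj|i hi]; first exact: inj.
exact: funS.
Qed.

Theorem lemma13 (R : realType) (d : nat) (l delta K gamma : R)
    (p q : {poly R}) (S : set R)
    (hd : (1 <= d)%N) (hl : 0 < l) (hdelta : 0 < delta) (hK : 0 < K)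
    (hgamma : 0 <= gamma)
    (hp : size p = d.+1) (hq : size q = d.+1)
    (hSl : S `<=` `[- l, l])
    (hSsep : delta_separated delta S)
    (hScard : (`I_(2 * d + 1) #<= S)%card)
    (hsup : (ereal_sup [set (`|p.[x] ^+ 2 - q.[x] ^+ 2|)%:E | x in S]
               <= gamma%:E)%E)
    (hinf : (K%:E <= ereal_inf [set (`|q.[x]|)%:E | x in S])%E) :
  `| `|p`_d| - `|q`_d| |
    <= 2 ^+ (2 * d + 1) * expR (2 * d)%:R * (d%:R * delta) ^- d * K^-1 * gamma.
Proof.
have hS x : S x ->
    `|p.[x] - q.[x]| <= gamma / K \/ `|p.[x] + q.[x]| <= gamma / K.
  move=> Sx.
  have h1 : `|p.[x] - q.[x]| * `|p.[x] + q.[x]| <= gamma.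
    rewrite -normrM -subr_sqr -lee_fin; apply: le_trans hsup.
    by apply: ereal_sup_ubound; exists x.
  have h2 : K <= `|q.[x]|.
    by rewrite -lee_fin; apply: le_trans hinf _; apply: ereal_inf_lbound; exists x.
  have h3 : 2 * `|q.[x]| <= `|p.[x] - q.[x]| + `|p.[x] + q.[x]|.
    have -> : 2 * `|q.[x]| = `|(p.[x] + q.[x]) - (p.[x] - q.[x])|.
      rewrite -[2 in LHS](ger0_norm (ler0n R 2)) -normrM; congr `| _ |; ring.
    by rewrite [leRHS]addrC; apply: ler_normB.
  have [n1 n2] : 0 <= `|p.[x] - q.[x]| /\ 0 <= `|p.[x] + q.[x]| by [].
  rewrite !ler_pdivlMr //.
  (* The larger factor is at least [K], half the lower bound on the sum, so the smaller one times
     [K] is at most [gamma]. *)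
  case: (leP `|p.[x] - q.[x]| `|p.[x] + q.[x]|) => h; [left | right]; nra.
have [f [finj fS]] := card_II_le_injection (T := R) hScard.
pose s := map f (iota 0 (2 * d + 1)).
have us : uniq s.
  rewrite map_inj_in_uniq ?iota_uniq // => i j; rewrite !mem_iota => hi hj.
  by apply: finj; rewrite inE.
have sS y : y \in s -> S y by case/mapP => i; rewrite mem_iota => hi ->; apply: fS.
have main (r : {poly R}) (a : pred R) : (size r <= d.+1)%N ->
    (d < count a s)%N -> (forall y, y \in s -> a y -> `|r.[y]| <= gamma / K) ->
    `|r`_d| <= 2 ^+ (2 * d + 1) * expR (2 * d)%:R * (d%:R * delta) ^- d
      * K^-1 * gamma.
  move=> sr ca ha.
  have ha' y : y \in [seq y <- s | a y] -> S y /\ `|r.[y]| <= gamma / K.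
    by rewrite mem_filter => /andP[ay ys]; split; [apply: sS | apply: ha].
  have := separated_coef_le hdelta hSsep sr _ _ ha'.
  rewrite size_filter filter_uniq // => /(_ ca isT).
  have df : 0 < d`!%:R :> R by rewrite ltr0n fact_gt0.
  have dd : 0 < (d%:R : R) ^+ d by rewrite exprn_gt0 // ltr0n.
  have de : 0 < delta ^+ d by rewrite exprn_gt0.
  have gK : 0 <= gamma / K by rewrite divr_ge0 // ltW.
  rewrite -ler_pdivlMr ?mulr_gt0 // => h; apply: le_trans h _.
  have e := exprn_le_expR_fact R d.
  have E1 : 1 <= expR (d%:R : R) by apply: le_trans (expR_ge1Dx _); rewrite lerDl ler0n.
  have T1 : 1 <= (2 : R) ^+ d.+1 by rewrite exprn_ege1 // ler1n.
  have T0 : 0 < (2 : R) ^+ d by rewrite exprn_gt0.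
  (* Isolating [gamma / K * 2 ^+ d] leaves a comparison of [1 / d!] with
     [2 ^+ d.+1 * e ^ (2d) / d ^ d]. One factor [e ^ d] absorbs [d ^ d / d!]; the remaining
     [2 ^+ d.+1 * e ^ d] is at least 1. *)
  have -> : 2 ^+ (2 * d + 1) * expR (2 * d)%:R * (d%:R * delta) ^- d * K^-1 * gamma
      = gamma / K * 2 ^+ d * (2 ^+ d.+1 * expR d%:R * expR d%:R / (d%:R ^+ d * delta ^+ d)).
    rewrite mul2n -addnn -addnA addn1 exprD natrD expRD exprMn.
    by field; rewrite ?lt0r_neq0.
  apply: ler_wpM2l; first by rewrite mulr_ge0 // ltW.
  rewrite ler_pdivlMr ?mulr_gt0 // mulrC invfM mulrA mulrAC mulfK ?lt0r_neq0 //.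
  rewrite ler_pdivrMr //; apply: le_trans e _; rewrite ler_pM2r //.
  by rewrite ler_peMl ?expR_ge0 // mulr_ege1.
pose a y := `|p.[y] - q.[y]| <= gamma / K.
(* Pigeonhole: of [2d + 1] points, at least [d + 1] satisfy [a] or at least [d + 1] fail it. Where
   [a] fails, [hS] makes [p + q] small. *)
have ss : (count a s + count (predC a) s = (d + d).+1)%N.
  by rewrite count_predC size_map size_iota mul2n -addnn addn1.
case: (ltnP d (count a s)) => ca.
  have := main (p - q) a; rewrite coefB => /(_ _ ca) h.
  apply: le_trans (h _ _); first exact: ler_dist_dist.
    by apply: leq_trans (size_polyD _ _) _; rewrite size_polyN hp hq maxnn.
  by move=> y _; rewrite hornerD hornerN.
have {}ca : (d < count (predC a) s)%N by rewrite -(leq_add2l d) addnS -ss leq_add2r.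
have := main (p + q) (predC a); rewrite coefD => /(_ _ ca) h.
apply: le_trans (h _ _).
(* Replacing [q_d] by its negative inside the absolute value lets the reverse triangle inequality
   produce the sum of the coefficients. *)
- rewrite -[q`_d in leLHS]opprK normrN.
  by apply: le_trans (ler_dist_dist _ _) _; rewrite opprK.
- by apply: leq_trans (size_polyD _ _) _; rewrite hp hq maxnn.
- by move=> y /sS /hS[]; rewrite /= /a hornerD // => ->.
Qed.
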